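(* There exist a universal polynomial $P$ in two variables and a universal constant $C<\infty$ (independent of $K$, $m$, $\alpha(\boldsymbol\phi)$ and all other model primitives) such that the following holds. Consider the closed-network joint entry-assignment model described in the context with $m=|V|>1$ nodes and stationary demand arrivals, i.e. $\boldsymbol\phi^t=\boldsymbol\phi$ for all $t$, with $\alpha(\boldsymbol\phi)>0$. Let $K_1=P(m,1/\alpha(\boldsymbol\phi))$. Then, for the congestion function $f(\bar q)=-\sqrt m\,\bar q^{-1/2}$ and any $K\ge K_1$, the Mirror Backpressure (MBP) policy satisfies the infinite-horizon guarantee $$L^{\mathrm{MBP}}\ \le\ M_2\,\frac1K,\qquad M_2=Cm^2 .$$
   Context: **Model (joint entry-assignment).** $V$ is a finite set of nodes, $m=|V|>1$, and $K$ is a positive integer (number of identical supply units). $\mathcal T$ is a finite set of demand types; each $\tau\in\mathcal T$ has nonempty pick-up and drop-off neighborhoods $\mathcal P(\tau),\mathcal D(\tau)\subseteq V$. For $\tau\in\mathcal T$, $j\in\mathcal P(\tau)$, $k\in\mathcal D(\tau)$ there is a payoff $w_{j\tau k}\in\mathbb R$, normalized so that $\max_{\tau,\,j\in\mathcal P(\tau),\,k\in\mathcal D(\tau)}|w_{j\tau k}|=1$. Time is slotted, $t=1,2,\dots$. The state at the start of period $t$ is the vector of queue lengths $\mathbf q[t]\in\Omega_K=\{\mathbf q\in\mathbb Z_{\ge0}^V:\sum_j q_j=K\}$. In period $t$ exactly one demand unit arrives; its type $\tau[t]$ equals $\tau$ with probability $\phi^t_\tau$, independently across periods, where $\boldsymbol\phi^t=(\phi^t_\tau)_{\tau\in\mathcal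 T}$ is a probability vector. After observing $\tau[t]=\tau$, the controller chooses $x_{j\tau k}[t]\in\{0,1\}$ for $j\in\mathcal P(\tau),k\in\mathcal D(\tau)$ with $\sum_{j,k}x_{j\tau k}[t]\le1$ and $x_{j\tau k}[t]=0$ whenever $q_j[t]=0$ (no-underflow); $x_{j\tau'k}[t]=0$ for $\tau'\ne\tau$. The payoff collected is $v[t]=\sum_{j,k}w_{j\tau k}x_{j\tau k}[t]$ and $\mathbf q[t+1]=\mathbf q[t]+\sum_{j,k}(-\mathbf e_j+\mathbf e_k)x_{j\tau k}[t]$, with $\mathbf e_i$ the unit vectors. A feasible policy maps the history of types and states up to time $t$ to a (possibly randomized) decision satisfying these constraints. **Performance.** $W_T^\pi=\min_{\mathbf q\in\Omega_K}\frac1T\sum_{t=1}^T\mathbb E[v^\pi[t]\mid\mathbf q[1]=\mathbf q]$; $W_T^*=\sup_{\pi}\max_{\mathbf q\in\Omega_K}\frac1T\sum_{t=1}^T\mathbb E[v^\pi[t]\mid\mathbf q[1]=\mathbf q]$, the supremum being over all feasible policies (which may depend on the arrival rates). $W^\pi=\liminf_{T\to\infty}W_T^\pi$, $W^*=\limsup_{T\to\infty}W_T^*$, and $L^\pi=W^*-W^\pi$. **Connectedness.** For a probability vector $\boldsymbol\phi$ on $\mathcal T$, $\alpha(\boldsymbol\phi)=\min_{\emptyset\ne S\subsetneq V}\sum_{\tau:\ \mathcal P(\tau)\cap S\neq\emptyset,\ \mathcal D(\tau)\cap(V\setminus S)\ne\emptyset}\phi_\tau$. **MBP policy.** Normalized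 queue lengths: $\bar q_j=\frac{q_j+\delta_K}{\tilde K}$ with $\delta_K=\sqrt K$, $\tilde K=K+m\sqrt K$. Given an increasing congestion function $f$, when a type-$\tau$ demand arrives in period $t$, MBP lets $(j^*,k^* )$ be a maximizer over $j\in\mathcal P(\tau),k\in\mathcal D(\tau)$ of $w_{j\tau k}+f(\bar q_j[t])-f(\bar q_k[t])$ (ties broken arbitrarily); it sets $x_{j^*\tau k^*}[t]=1$ (all other $x=0$) if this maximum is $\ge0$ and $q_{j^*}[t]>0$, and otherwise drops the demand (all $x=0$). *)

(* Defs.v *)
From HB Require Import structures.
From mathcomp Require Import all_boot all_order all_algebra.
From mathcomp Require Import all_classical all_reals all_analysis.

Set Implicit Arguments.
Unset Strict Implicit.
Unset Printing Implicit Defensive.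

Import Order.TTheory GRing.Theory Num.Theory.
Import numFieldNormedType.Exports.

Local Open Scope classical_set_scope.
Local Open Scope ring_scope.

(* The maximum is taken of nonnegative numbers, hence the neutral element 0. *)
Record network (R : realType) (V Ty : finType) := Network {
  pickup : Ty -> {set V};
  dropoff : Ty -> {set V};
  weight : V -> Ty -> V -> R;
  pickup_neq0 : forall tau, pickup tau != finset.set0;
  dropoff_neq0 : forall tau, dropoff tau != finset.set0;
  weight_normalized :
    \big[Num.max/0]_(tau : Ty) \big[Num.max/0]_(j in pickup tau)
      \big[Num.max/0]_(k in dropoff tau) `|weight j tau k| = 1
}.

Definition is_prob_vector (R : realType) (A : finType) (p : A -> R) : Prop :=
  (forall a, 0 <= p a) /\ \sum_a p a = 1.

(* [x (j, tau, k)] says whether [x_{j tau k} = 1]. *)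
Definition decision (V Ty : finType) : finType := {ffun V * Ty * V -> bool}.

Definition state (V : finType) := {ffun V -> nat}.

Definition Omega (V : finType) (K : nat) : set (state V) :=
  [set q : state V | (\sum_j q j)%N = K].

Section Model.
Variables (R : realType) (V Ty : finType) (N : network R V Ty).

Definition feasible (q : state V) (tau : Ty) (x : decision V Ty) : Prop :=
  [/\ forall j tau' k, x (j, tau', k) ->
        [/\ tau' = tau, j \in pickup N tau & k \in dropoff N tau],
      (\sum_j \sum_k x (j, tau, k) <= 1)%N &
      forall j k, q j = 0%N -> x (j, tau, k) = false].

Definition payoff (tau : Ty) (x : decision V Ty) : R :=
  \sum_j \sum_k weight N j tau k * (x (j, tau, k))%:R.

(* For a feasible [x] at most one unit leaves node [i], and only if [q i > 0],
   so the truncated subtraction is exact (arrivals are added first). *)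
Definition next_state (q : state V) (tau : Ty) (x : decision V Ty) : state V :=
  [ffun i => (q i + \sum_j x (j, tau, i) - \sum_k x (i, tau, k))%N].

(* The list of (state, type) pairs of the past periods, oldest first. *)
Definition history := seq (state V * Ty).

(* [kernel h q tau x] is the probability of choosing [x] in period
   [(size h).+1], after history [h], in state [q] with an arrival of type
   [tau]. *)
Record policy := Policy {
  kernel :> history -> state V -> Ty -> decision V Ty -> R;
  kernel_prob : forall h q tau, is_prob_vector (kernel h q tau);
  kernel_feasible :
    forall h q tau x, 0 < kernel h q tau x -> feasible q tau x
}.

(* Probability that, after history [h] and from state [q], the next arrivals
   and decisions are those listed in [s]; [phi t tau] is the probability that
   the demand of period [t = 1, 2, ...] has type [tau]. *)
Fixpoint path_prob (phi : nat -> Ty -> R) (pi : policy) (h : history)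
    (q : state V) (s : seq (Ty * decision V Ty)) : R :=
  if s is (tau, x) :: s' then
    phi (size h).+1 tau * pi h q tau x *
      path_prob phi pi (rcons h (q, tau)) (next_state q tau x) s'
  else 1.

(* Expectation, given [q[1] = q], of a function of the first [T] periods. *)
Definition expect (phi : nat -> Ty -> R) (pi : policy) (q : state V) (T : nat)
    (X : T.-tuple (Ty * decision V Ty) -> R) : R :=
  \sum_(s : T.-tuple (Ty * decision V Ty)) path_prob phi pi [::] q s * X s.

(* [t : 'I_T] stands for period [t.+1]. *)
Definition avg_payoff (phi : nat -> Ty -> R) (pi : policy) (q : state V)
    (T : nat) : R :=
  T%:R^-1 * \sum_(t < T)
    expect phi pi q (fun s : T.-tuple _ => payoff (tnth s t).1 (tnth s t).2).

(* [@Omega V K] is finite, and nonempty when [V] is, so [inf] and the inner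
   [sup] below are a minimum and a maximum. *)
Definition W_T (phi : nat -> Ty -> R) (K : nat) (pi : policy) (T : nat) : R :=
  inf [set avg_payoff phi pi q T | q in @Omega V K].

Definition Wstar_T (phi : nat -> Ty -> R) (K : nat) (T : nat) : R :=
  sup [set sup [set avg_payoff phi pi q T | q in @Omega V K]
      | pi in [set: policy]].

Definition W (phi : nat -> Ty -> R) (K : nat) (pi : policy) : R :=
  limn_inf (W_T phi K pi).

Definition Wstar (phi : nat -> Ty -> R) (K : nat) : R :=
  limn_sup (Wstar_T phi K).

Definition loss (phi : nat -> Ty -> R) (K : nat) (pi : policy) : R :=
  Wstar phi K - W phi K pi.

(* The neutral element 1 is harmless: the sums are at most 1 for a probability
   vector, and there is a nonempty proper [S] as soon as [#|V| > 1]. *)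
Definition alpha (phi : Ty -> R) : R :=
  \big[Num.min/1]_(S : {set V} | (S != finset.set0) && (S \proper V))
    \sum_(tau | (pickup N tau :&: S != finset.set0) &&
                (dropoff N tau :&: ~: S != finset.set0)) phi tau.

Definition qbar (K : nat) (q : state V) (j : V) : R :=
  ((q j)%:R + Num.sqrt K%:R) / (K%:R + #|V|%:R * Num.sqrt K%:R).

Definition score (f : R -> R) (K : nat) (q : state V) (tau : Ty) (j k : V) : R :=
  weight N j tau k + f (qbar K q j) - f (qbar K q k).

Definition mbp_maximizer (f : R -> R) (K : nat) (q : state V) (tau : Ty)
    (j k : V) : Prop :=
  [/\ j \in pickup N tau, k \in dropoff N tau &
      forall j' k', j' \in pickup N tau -> k' \in dropoff N tau ->
        score f K q tau j' k' <= score f K q tau j k].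

Definition mbp_decision (f : R -> R) (K : nat) (q : state V) (tau : Ty)
    (x : decision V Ty) : Prop :=
  exists j k, mbp_maximizer f K q tau j k /\
    x = if (0 <= score f K q tau j k) && (0 < q j)%N
        then [ffun e => e == (j, tau, k)] else [ffun=> false].

(* Ties are broken arbitrarily: the choice among maximizers may depend on the
   history and be randomized. *)
Definition is_MBP (f : R -> R) (K : nat) (pi : policy) : Prop :=
  forall h q tau x, Omega K q -> 0 < pi h q tau x -> mbp_decision f K q tau x.

End Model.

Definition sqrt_congestion (R : realType) (m : nat) (y : R) : R :=
  - Num.sqrt m%:R * y `^ (- 2^-1).

(* Main.v *)
Require Import Defs.
From mathcomp Require Import all_boot all_order all_algebra.
From mathcomp Require Import all_classical all_reals all_analysis.
From mathcomp Require Import zify ring lra.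

Set Implicit Arguments.
Unset Strict Implicit.
Unset Printing Implicit Defensive.

Import Order.TTheory GRing.Theory Num.Theory.
Local Open Scope ring_scope.

(** Let [g y] be the expectation over [tau] of
    [max (0, max_(j, k) (w_(j tau k) + y_j - y_k))].  Weak duality, with the
    potential [- sum_i y_i q_i], gives [W* <= g y] for every [y].  Conversely,
    MBP collects the payoff [g (f qbar)] per period, up to the increment of the
    potential [sum_i F qbar_i], [F' = f], the second-order term of that
    increment, and at most 1 whenever a node is empty.  Since [f' qbar] is of
    order [m^2] at balanced states, the second-order term is [O(m^2 / K)] there.
    At unbalanced states it is absorbed by
    [g y >= W* + alpha * (max y - min y - 2 m)], which holds because closing a
    gap larger than 2 between the values of [y] by [d] decreases [g] by at least
    [alpha * d]; this is where [K] must be polynomially large. *)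

(** * Limits superior and inferior from finite-horizon bounds with error [c / T] *)

Section LimSupInf.
Variable R : realType.
Implicit Types (u : nat -> R) (l c M : R).

Lemma bounded_fun_norm_le u M : (forall n, `|u n| <= M) -> bounded_fun u.
Proof.
move=> uM; exists M; split; first exact: num_real.
by move=> x Mx n _ /=; exact: le_trans (uM n) (ltW Mx).
Qed.

Lemma le_of_le_add_inv l l' c : (forall n, l <= l' + c / n.+1%:R) -> l <= l'.
Proof.
move=> H; apply/ler_addgt0Pr => e e0.
have [c0|c0] := leP c 0.
  by have := H 0; rewrite divr1; lra.
have [n Hn] : exists n : nat, c / e < n.+1%:R.
  exists (Num.truncn (c / e)); exact: truncnS_gt.
apply: (le_trans (H n)); rewrite lerD2l ler_pdivrMr ?ltr0Sn//.
by rewrite mulrC -ler_pdivrMr// ltW.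
Qed.

(** All terms from index [n.+1] on are at most [l + c / n.+1], hence so is their supremum. Only
    positive indices are constrained, since the horizon 0 carries no information. *)
Lemma limn_sup_le u l c M : (forall n, `|u n| <= M) ->
  (forall n, u n.+1 <= l + c / n.+1%:R) -> 0 <= c -> limn_sup u <= l.
Proof.
move=> uM uc c0; have bu := bounded_fun_norm_le uM.
rewrite limn_supE//; apply: (@le_of_le_add_inv _ _ c) => n.
apply: (@le_trans _ _ (sups u n.+1)).
  by apply: ge_inf; [exact: bounded_fun_has_lbound_sups | exists n.+1].
apply: ge_sup; first by exists (u n.+1); exists n.+1 => //=.
move=> _ [[//|k] /= nk <-]; apply: (le_trans (uc k)).
by rewrite lerD2l ler_wpM2l// lef_pV2 ?posrE ?ltr0Sn// ler_nat.
Qed.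

Lemma limn_inf_ge u l c M : (forall n, `|u n| <= M) ->
  (forall n, l - c / n.+1%:R <= u n.+1) -> 0 <= c -> l <= limn_inf u.
Proof.
move=> uM uc c0; have bu := bounded_fun_norm_le uM.
rewrite limn_infE//; apply: (@le_of_le_add_inv _ _ c) => n.
rewrite -lerBlDr; apply: (@le_trans _ _ (infs u n.+1)); last first.
  by apply: ub_le_sup; [exact: bounded_fun_has_ubound_infs | exists n.+1].
apply: lb_le_inf; first by exists (u n.+1); exists n.+1 => //=.
move=> _ [[//|k] /= nk <-]; apply: le_trans (uc k).
by rewrite lerD2l lerN2 ler_wpM2l// lef_pV2 ?posrE ?ltr0Sn// ler_nat.
Qed.

End LimSupInf.

Lemma big_tuple_recl (R : nmodType) (A : finType) n (G : n.+1.-tuple A -> R) :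
  \sum_s G s = \sum_a \sum_(s : n.-tuple A) G (cons_tuple a s).
Proof.
rewrite pair_big /= (reindex (fun p : A * n.-tuple A => cons_tuple p.1 p.2))//=.
exists (fun s => (thead s, behead_tuple s)) => [[a s] _|s _] /=.
  by congr pair; apply: val_inj.
by rewrite [RHS]tuple_eta.
Qed.

Lemma big_tuple0 (R : nmodType) (A : finType) (G : 0.-tuple A -> R) : \sum_s G s = G [tuple].
Proof.
rewrite (bigD1 [tuple])//= big1 ?addr0// => s.
by move=> /negP[]; apply/eqP; exact: tuple0.
Qed.

(** * One period of the model *)

Section Step.
Variables (R : realType) (V Ty : finType) (N : network R V Ty).
Implicit Types (q : state V) (tau : Ty) (x : decision V Ty).

Definition move q j k : state V := [ffun i => (q i + (i == k) - (i == j))%N].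

Lemma weight_le1 j tau k : j \in pickup N tau -> k \in dropoff N tau ->
  `|weight N j tau k| <= 1.
Proof.
move=> jP kD; rewrite -(weight_normalized N).
apply: le_trans (le_bigmax _ _ tau).
apply: le_trans (le_bigmax_cond _ _ jP).
exact: le_bigmax_cond.
Qed.

Lemma payoff_serve tau j k :
  payoff N tau [ffun e => e == (j, tau, k)] = weight N j tau k.
Proof.
rewrite /payoff (bigD1 j)//= (bigD1 k)//= ffunE eqxx mulr1 !big1 ?addr0//.
  by move=> i ij; rewrite big1// => l _; rewrite ffunE !xpair_eqE (negPf ij) mulr0.
by move=> l lk; rewrite ffunE !xpair_eqE (negPf lk) !andbF mulr0.
Qed.

Lemma payoff_drop tau : payoff N tau [ffun=> false] = 0.
Proof. by rewrite /payoff big1// => i _; rewrite big1// => l _; rewrite ffunE mulr0. Qed.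

Lemma next_state_serve q tau j k :
  next_state q tau [ffun e => e == (j, tau, k)] = move q j k.
Proof.
apply/ffunP => i; rewrite !ffunE; congr (_ + _ - _)%N.
  rewrite (bigD1 j)//= ffunE !xpair_eqE !eqxx/= big1 ?addn0// => l lj.
  by rewrite ffunE !xpair_eqE (negPf lj).
rewrite (bigD1 k)//= ffunE !xpair_eqE !eqxx/= !andbT big1 ?addn0// => l lk.
by rewrite ffunE !xpair_eqE (negPf lk) andbF.
Qed.

Lemma next_state_drop q tau : next_state q tau [ffun=> false] = q.
Proof.
by apply/ffunP => i; rewrite !ffunE !big1 ?addn0 ?subn0// => l _; rewrite ffunE.
Qed.

(** Since at most one entry of a feasible decision is set, case analysis on this predicate replaces
    the decision by an explicit function. *)
Variant feasible_spec q tau : decision V Ty -> Prop :=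
| FeasibleDrop : feasible_spec q tau [ffun=> false]
| FeasibleServe j k of j \in pickup N tau & k \in dropoff N tau & (0 < q j)%N :
    feasible_spec q tau [ffun e => e == (j, tau, k)].

Lemma feasibleP q tau x : feasible N q tau x -> feasible_spec q tau x.
Proof.
move=> [xP x1 x0].
have [[[j tau'] k] /= xj|xn] := pickP x; last first.
  suff -> : x = [ffun=> false] by constructor.
  by apply/ffunP => e; rewrite ffunE xn.
have [E jP kD] := xP _ _ _ xj; subst tau'.
have qj : (0 < q j)%N by rewrite lt0n; apply/eqP => /(x0 _ k); rewrite xj.
suff -> : x = [ffun e => e == (j, tau, k)] by constructor.
apply/ffunP => -[[j' tau'] k']; rewrite ffunE.
case: eqP => [[-> -> ->]//|ne]; apply/negbTE/negP => xj'.
have [E _ _] := xP _ _ _ xj'; subst tau'.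
move: x1; rewrite pair_big /= (bigD1 (j, k))//= xj (bigD1 (j', k'))//= ?xj'//.
by apply/eqP => -[? ?]; apply: ne; congr (_, _, _).
Qed.

Lemma move_id q j : (0 < q j)%N -> move q j j = q.
Proof. by move=> qj; apply/ffunP => i; rewrite ffunE addnK. Qed.

(** Used with [F i n] equal to [n] (conservation of units), to [y i * n] (weak duality) and to the
    mirror potential of one node. The case [j = k] is left to [move_id]. *)
Lemma sum_move q j k (F : V -> nat -> R) : (0 < q j)%N -> j != k ->
  \sum_i F i (move q j k i) = \sum_i F i (q i) +
    (F j (q j).-1 - F j (q j)) + (F k (q k).+1 - F k (q k)).
Proof.
move=> qj jk; have kj : k != j by rewrite eq_sym.
rewrite (bigD1 j)//= (bigD1 k)//= [X in _ = X + _ + _](bigD1 j)//=.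
rewrite [in RHS](bigD1 k)//=.
rewrite !ffunE !eqxx (negPf jk) (negPf kj) addn0 subn1 addn1 subn0.
rewrite (eq_bigr (fun i => F i (q i))); first by ring.
by move=> i /andP[ij ik]; rewrite ffunE (negPf ij) (negPf ik) addn0 subn0.
Qed.

Lemma next_state_Omega K q tau x :
  feasible N q tau x -> Omega K q -> Omega K (next_state q tau x).
Proof.
rewrite /Omega /= => /feasibleP[|j k jP kD qj] <-.
  by rewrite next_state_drop.
rewrite next_state_serve; have [<-|jk] := eqVneq j k; first by rewrite move_id.
(* The count is computed in [R], so that [sum_move] applies. *)
apply/eqP; rewrite -(eqr_nat R) !natr_sum; apply/eqP.
rewrite (sum_move (fun _ n => n%:R))//=.
have -> : (q j)%:R = (q j).-1%:R + 1 :> R by rewrite natr1 prednK.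
by rewrite -natr1; ring.
Qed.

End Step.

(** * Expectations along trajectories *)

Section Paths.
Variables (R : realType) (V Ty : finType) (N : network R V Ty).
Variables (phi : Ty -> R) (pi : policy N).
Hypothesis phi_prob : is_prob_vector phi.
Let phi_t : nat -> Ty -> R := fun=> phi.

Lemma sum_step_prob h q : \sum_tau \sum_x phi tau * pi h q tau x = 1.
Proof.
rewrite -[RHS](proj2 phi_prob); apply: eq_bigr => tau _.
by rewrite -big_distrr /= (proj2 (kernel_prob pi h q tau)) mulr1.
Qed.

Lemma path_prob_recl n h q (G : seq (Ty * decision V Ty) -> R) :
  \sum_(s : n.+1.-tuple _) path_prob phi_t pi h q s * G s =
  \sum_tau \sum_x phi tau * pi h q tau x *
    \sum_(s : n.-tuple _)
      path_prob phi_t pi (rcons h (q, tau)) (next_state q tau x) s *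
      G ((tau, x) :: s).
Proof.
rewrite big_tuple_recl [RHS]pair_big /=; apply: eq_bigr => -[tau x] _ /=.
by rewrite big_distrr /=; apply: eq_bigr => s _; rewrite mulrA.
Qed.

Lemma sum_path_prob n h q :
  \sum_(s : n.-tuple _) path_prob phi_t pi h q s = 1.
Proof.
elim: n h q => [|n IHn] h q; first by rewrite big_tuple0.
rewrite -[RHS](sum_step_prob h q).
have /= := path_prob_recl n h q (fun=> 1).
under eq_bigr do rewrite mulr1; move=> ->.
apply: eq_bigr => tau _; apply: eq_bigr => x _.
by under eq_bigr do rewrite mulr1; rewrite IHn mulr1.
Qed.

(** Lyapunov argument: the drift inequality telescopes along trajectories and the last potential is
    at least [L]. The term [b] depends only on state and type, so it can be averaged over the
    arrival whatever the policy does. The history [h] is general because the policy may depend on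
    it. *)
Lemma drift_path K (r : Ty -> decision V Ty -> R) (Phi : state V -> R)
    (b : state V -> Ty -> R) (c L : R) :
  (forall q, Omega K q -> L <= Phi q) ->
  (forall q, Omega K q -> \sum_tau phi tau * b q tau <= c) ->
  (forall h q tau x, Omega K q -> 0 < pi h q tau x ->
     r tau x + Phi (next_state q tau x) <= Phi q + b q tau) ->
  forall n h q, Omega K q ->
    \sum_(s : n.-tuple _) path_prob phi_t pi h q s *
      \sum_(a <- s) r a.1 a.2 <= Phi q - L + n%:R * c.
Proof.
move=> PhiL bc drift; elim=> [|n IHn] h q Kq.
  by rewrite big_tuple0 /= big_nil mulr0 mul0r addr0 subr_ge0 PhiL.
rewrite (path_prob_recl n h q (fun s => \sum_(a <- s) r a.1 a.2)).
have [phi_ge0 phi1] := phi_prob.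
apply: (@le_trans _ _ (\sum_tau \sum_x phi tau * pi h q tau x *
    (Phi q + b q tau - L + n%:R * c))).
  apply: ler_sum => tau _; apply: ler_sum => x _.
  (* Feasibility and drift are known only for decisions of positive probability; the others
     contribute 0. *)
  have := proj1 (kernel_prob pi h q tau) x; rewrite le_eqVlt => /orP[/eqP<-|p0].
    by rewrite mulr0 !mul0r.
  rewrite ler_wpM2l ?mulr_ge0 ?(ltW p0)//.
  rewrite (eq_bigr (fun s : n.-tuple _ =>
    path_prob phi_t pi (rcons h (q, tau)) (next_state q tau x) s * r tau x +
    path_prob phi_t pi (rcons h (q, tau)) (next_state q tau x) s *
      \sum_(a <- s) r a.1 a.2)); last first.
    by move=> s _; rewrite big_cons mulrDr.
  rewrite big_split /= -big_distrl /= sum_path_prob mul1r.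
  have := IHn (rcons h (q, tau)) _
    (next_state_Omega (kernel_feasible p0) Kq).
  have := drift h q tau x Kq p0.
  lra.
have -> : Phi q - L + n.+1%:R * c = c + (Phi q - L + n%:R * c).
  by rewrite -natr1; ring.
rewrite (eq_bigr (fun tau => phi tau * b q tau +
   phi tau * (Phi q - L + n%:R * c))); last first.
  move=> tau _; rewrite -big_distrl/= -big_distrr/=.
  by rewrite (proj2 (kernel_prob pi h q tau)); ring.
by rewrite big_split /= -big_distrl /= phi1 mul1r lerD2r bc.
Qed.

Lemma avg_payoffE q T : avg_payoff phi_t pi q T =
  T%:R^-1 * \sum_(s : T.-tuple _) path_prob phi_t pi [::] q s *
    \sum_(a <- s) payoff N a.1 a.2.
Proof.
congr (_ * _); rewrite exchange_big /=; apply: eq_bigr => s _.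
by rewrite -big_distrr /= big_tuple.
Qed.

(** The potential varies by at most [2 * B], an amount shared among [T.+1] periods. *)
Lemma avg_payoff_le K (Phi : state V -> R) (b : state V -> Ty -> R) (c B : R) :
  (forall q, Omega K q -> `|Phi q| <= B) ->
  (forall q, Omega K q -> \sum_tau phi tau * b q tau <= c) ->
  (forall h q tau x, Omega K q -> 0 < pi h q tau x ->
     payoff N tau x + Phi (next_state q tau x) <= Phi q + b q tau) ->
  forall T q, Omega K q ->
    avg_payoff phi_t pi q T.+1 <= c + 2 * B / T.+1%:R.
Proof.
move=> PhiB bc drift T q Kq.
have PhiL q' : Omega K q' -> - B <= Phi q'.
  by move=> /PhiB; rewrite ler_norml => /andP[].
have := drift_path PhiL bc drift T.+1 [::] Kq.
have := PhiB q Kq; rewrite ler_norml => /andP[_ PhiqB] H.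
rewrite avg_payoffE mulrC ler_pdivrMr ?ltr0Sn// mulrDl divfK ?pnatr_eq0//.
by apply: (le_trans H); rewrite mulrC; lra.
Qed.

Lemma avg_payoff_ge K (Phi : state V -> R) (b : state V -> Ty -> R) (c B : R) :
  (forall q, Omega K q -> `|Phi q| <= B) ->
  (forall q, Omega K q -> \sum_tau phi tau * b q tau <= - c) ->
  (forall h q tau x, Omega K q -> 0 < pi h q tau x ->
     - payoff N tau x + Phi (next_state q tau x) <= Phi q + b q tau) ->
  forall T q, Omega K q ->
    c - 2 * B / T.+1%:R <= avg_payoff phi_t pi q T.+1.
Proof.
move=> PhiB bc drift T q Kq.
have PhiL q' : Omega K q' -> - B <= Phi q'.
  by move=> /PhiB; rewrite ler_norml => /andP[].
have := drift_path (r := fun tau x => - payoff N tau x) PhiL bc drift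
  T.+1 [::] Kq.
have := PhiB q Kq; rewrite ler_norml => /andP[_ PhiqB].
under eq_bigr do rewrite sumrN mulrN; rewrite sumrN => H.
rewrite avg_payoffE [leRHS]mulrC ler_pdivlMr ?ltr0Sn// mulrBl divfK ?pnatr_eq0//.
by rewrite lerBlDr -lerBlDl; move: H; rewrite mulrN; lra.
Qed.

Lemma payoff_norm_le1 q tau x : feasible N q tau x -> `|payoff N tau x| <= 1.
Proof.
move=> /feasibleP[|j k jP kD _]; first by rewrite payoff_drop normr0 ler01.
by rewrite payoff_serve weight_le1.
Qed.

(** Provides the boundedness required of the sets and sequences whose suprema, infima and limits
    define [W] and [Wstar]. *)
Lemma avg_payoff_norm_le1 K T q : Omega K q -> `|avg_payoff phi_t pi q T| <= 1.
Proof.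
case: T => [|T] Kq; first by rewrite avg_payoffE invr0 mul0r normr0 ler01.
have le1 c (q' : state V) : Omega K q' -> \sum_tau phi tau * (fun _ _ => c) q' tau <= c.
  by move=> _; rewrite -big_distrl /= (proj2 phi_prob) mul1r.
(* The zero potential leaves no error term. *)
have Phi0 (q' : state V) : Omega K q' -> `|(fun=> 0 : R) q'| <= 0 by rewrite normr0.
have v1 h q' tau x : 0 < pi h q' tau x -> -1 <= payoff N tau x <= 1.
  by move=> /(kernel_feasible (p := pi)) /payoff_norm_le1; rewrite ler_norml.
rewrite ler_norml; apply/andP; split.
  have := avg_payoff_ge (c := -1) (b := fun _ _ => 1) Phi0 _ _ T Kq.
  rewrite mulr0 mul0r subr0; apply.
  - by move=> q' /(le1 1); rewrite opprK.
  - by move=> h q' tau x _ /v1 /andP[]; lra.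
have := avg_payoff_le (c := 1) (b := fun _ _ => 1) Phi0 _ _ T Kq.
rewrite mulr0 mul0r addr0; apply; first exact: le1.
by move=> h q' tau x _ /v1 /andP[]; lra.
Qed.

End Paths.

(** * Dual bound on the optimal payoff *)

Section Dual.
Variables (R : realType) (V Ty : finType) (N : network R V Ty).
Variable phi : Ty -> R.
Implicit Types (y : V -> R) (S : {set V}) (tau : Ty).

(** The neutral element 0 is the value of dropping the demand. *)
Definition dual_type y tau : R :=
  \big[Num.max/0]_(p : V * V | (p.1 \in pickup N tau) && (p.2 \in dropoff N tau))
    (weight N p.1 tau p.2 + y p.1 - y p.2).

(* Objective of the dual of the static planning problem. *)
Definition dual y : R := \sum_tau phi tau * dual_type y tau.

Lemma dual_type_ge0 y tau : 0 <= dual_type y tau.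
Proof. exact: bigmax_ge_id. Qed.

Lemma dual_type_ge y tau j k : j \in pickup N tau -> k \in dropoff N tau ->
  weight N j tau k + y j - y k <= dual_type y tau.
Proof.
move=> jP kD.
by apply: (le_bigmax_cond _ (fun p : V * V => weight N p.1 tau p.2 + y p.1 - y p.2)
  (j := (j, k))); rewrite /= jP kD.
Qed.

Lemma dual_type_le y tau M : 0 <= M ->
  (forall j k, j \in pickup N tau -> k \in dropoff N tau ->
     weight N j tau k + y j - y k <= M) ->
  dual_type y tau <= M.
Proof.
by move=> M0 H; apply: bigmax_le => // -[j k] /= /andP[]; exact: H.
Qed.

Definition crossing S tau :=
  (pickup N tau :&: S != finset.set0) && (dropoff N tau :&: ~: S != finset.set0).

Lemma alpha_le1 : alpha N phi <= 1.
Proof. exact: bigmin_le_id. Qed.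

Lemma alpha_le_cut S : S != finset.set0 -> S \proper V ->
  alpha N phi <= \sum_(tau | crossing S tau) phi tau.
Proof. by move=> S0 SV; apply: bigmin_le_cond; rewrite S0 SV. Qed.

Hypothesis phi_ge0 : forall tau, 0 <= phi tau.

(* A gap of at least 2 already forces every crossing type to be served across
   the cut, whatever the payoffs; from there on the dual is affine in the gap. *)
Lemma dual_shift y S d : 0 <= d -> S != finset.set0 -> S \proper V ->
  (forall i k, i \in S -> k \notin S -> y k + 2 + d <= y i) ->
  dual (fun i => if i \in S then y i - d else y i) + alpha N phi * d <= dual y.
Proof.
move=> d0 S0 SV gap; set y' := fun i => _.
apply: (@le_trans _ _ (dual y' + \sum_(tau | crossing S tau) phi tau * d)).
  by rewrite lerD2l -big_distrl /= ler_wpM2r// alpha_le_cut.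
rewrite big_mkcond /= -big_split /=; apply: ler_sum => tau _.
have -> : phi tau * dual_type y' tau + (if crossing S tau then phi tau * d else 0)
    = phi tau * (dual_type y' tau + (if crossing S tau then d else 0)).
  by case: ifP => _; ring.
rewrite ler_wpM2l// -lerBrDr.
have wP j k : j \in pickup N tau -> k \in dropoff N tau ->
    -1 <= weight N j tau k <= 1.
  by move=> jP kD; rewrite -ler_norml weight_le1.
have [|ncross] := ifPn.
  move=> /andP[/set0Pn[j0]]; rewrite inE => /andP[j0P j0S].
  move=> /set0Pn[k0]; rewrite !inE => /andP[k0D k0S].
  have g00 := dual_type_ge y j0P k0D; have /andP[w00 _] := wP _ _ j0P k0D.
  have s00 := gap _ _ j0S k0S.
  apply: dual_type_le => [|j k jP kD]; first lra.
  have gjk := dual_type_ge y jP kD; have /andP[wjk wjk'] := wP _ _ jP kD.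
  have g0k := dual_type_ge y j0P kD; have /andP[w0k _] := wP _ _ j0P kD.
  have gj0 := dual_type_ge y jP k0D; have /andP[wj0 _] := wP _ _ jP k0D.
  (* When [j] and [k] lie on the same side of the cut, replacing one of them by [j0] or [k0] makes
     the pair cross the gap; the margin 2 outweighs the difference of two payoffs in [[-1, 1]]. *)
  rewrite /y'; have [jS|jS] := boolP (j \in S); have [kS|kS] := boolP (k \in S).
  - by have := gap _ _ kS k0S; lra.
  - lra.
  - by have := gap _ _ kS jS; lra.
  - by have := gap _ _ j0S jS; lra.
(* Without crossing, no pair goes from [S] to its complement, and a pair in the opposite direction
   keeps a negative score after the shift. *)
rewrite subr0; apply: dual_type_le => [|j k jP kD]; first exact: dual_type_ge0.
have gjk := dual_type_ge y jP kD; have /andP[wjk wjk'] := wP _ _ jP kD.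
have g0 := dual_type_ge0 y tau.
rewrite /y'; have [jS|jS] := boolP (j \in S); have [kS|kS] := boolP (k \in S).
- lra.
- move: ncross; rewrite negb_and !negbK => /orP[] /eqP/setP.
    by move=> /(_ j); rewrite !inE jP jS.
  by move=> /(_ k); rewrite !inE kD kS.
- by have := gap _ _ kS jS; lra.
- lra.
Qed.

(* Sweep the nodes upwards from [b], closing every gap larger than 2: [A] is the
   set of nodes already swept. *)
Lemma dual_spread_sweep w a b :
  0 <= alpha N phi -> (forall y, w <= dual y) -> forall n y (A : {set V}),
  (#|~: A| <= n)%N -> b \in A ->
  (forall i j, i \in A -> j \notin A -> y i <= y j) ->
  (forall i, i \in A -> y i <= y b + 2 * #|A|%:R) ->
  w + alpha N phi * (y a - y b - 2 * #|V|%:R) <= dual y.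
Proof.
move=> al0 wd.
(* Once [a] is swept, the bonus term is nonpositive and [w <= dual y] suffices. *)
have swept y (A : {set V}) : a \in A ->
    (forall i, i \in A -> y i <= y b + 2 * #|A|%:R) ->
    w + alpha N phi * (y a - y b - 2 * #|V|%:R) <= dual y.
  move=> aA /(_ a aA) ya; have Am : #|A|%:R <= #|V|%:R :> R.
    by rewrite ler_nat max_card.
  have u0 : y a - y b - 2 * #|V|%:R <= 0 by lra.
  by have := mulr_ge0_le0 al0 u0; have := wd y; lra.
elim=> [|n IHn] y A An bA low bd; have [aA|aA] := boolP (a \in A).
- exact: (swept y A aA bd).
- by move: An; rewrite leqn0 cards_eq0 => /eqP/setP/(_ a); rewrite !inE aA.
- exact: (swept y A aA bd).
have aC : a \in ~: A by rewrite inE.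
case: (@arg_minP _ _ _ a (fun i => i \notin A) y aA) => j jA jmin.
have cA : #|j |: A|%:R = #|A|%:R + 1 :> R by rewrite cardsU1 jA natrD addrC.
have cC : (#|~: (j |: A)| <= n)%N.
  have : ((j |: A) != A)%N by apply/eqP => /setP/(_ j); rewrite !inE eqxx (negPf jA).
  by have := cardsC A; have := cardsC (j |: A); rewrite cardsU1 jA; lia.
have [small|big] := leP (y j) (y b + 2 * #|A|%:R + 2).
  apply: (IHn y (j |: A)) => //; first by rewrite !inE bA orbT.
    move=> i k; rewrite !inE negb_or => iA /andP[kj kA].
    case/orP: iA => [/eqP->|iA]; last exact: low.
    exact: jmin.
  move=> i; rewrite !inE cA => /orP[/eqP->|/bd]; lra.
(* Lowering all unswept nodes by [d] puts [j] exactly at the bound required of [j |: A]. The value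
   at [a] falls by [d] too, which the gain [alpha * d] of [dual_shift] compensates. *)
set d := y j - (y b + 2 * #|A|%:R + 2).
have d0 : 0 <= d by rewrite /d; lra.
have S0 : ~: A != finset.set0 by apply/set0Pn; exists a.
have SV : ~: A \proper V.
  by apply/properP; split; [exact/fintype.subsetP | exists b; rewrite ?inE// bA].
apply: le_trans (dual_shift d0 S0 SV _); last first.
  move=> i k; rewrite !inE negbK => iA kA; rewrite /d.
  by have := bd k kA; have := jmin i iA; lra.
set y' := fun i => _.
have y'A i : i \in A -> y' i = y i by move=> iA; rewrite /y' inE iA.
have y'C i : i \notin A -> y' i = y i - d by move=> iA; rewrite /y' inE iA.
have := IHn y' (j |: A) cC.
rewrite (y'A b)// (y'C a)// => H.
suff : w + alpha N phi * (y a - d - y b - 2 * #|V|%:R) <= dual y' by lra.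
apply: H; first by rewrite !inE bA orbT.
  move=> i k; rewrite !inE negb_or => iA /andP[kj kA].
  rewrite (y'C k)//; have jk : y j <= y k by exact: jmin.
  case/orP: iA => [/eqP->|iA]; first by rewrite (y'C j)//; lra.
  by rewrite (y'A i)// /d; have := bd i iA; lra.
move=> i; rewrite !inE cA => /orP[/eqP->|iA]; first by rewrite (y'C j)// /d; lra.
by rewrite (y'A i)//; have := bd i iA; lra.
Qed.

Lemma dual_spread w y a b : 0 <= alpha N phi -> (forall y, w <= dual y) ->
  w + alpha N phi * (y a - y b - 2 * #|V|%:R) <= dual y.
Proof.
move=> al0 wd.
(* The sweep starts from the sublevel set of [y b], whose elements satisfy the bound trivially. *)
apply: (@dual_spread_sweep w a b al0 wd #|V| y [set i | y i <= y b]).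
- exact: max_card.
- by rewrite inE.
- by move=> i j; rewrite !inE -ltNge => ib bj; exact: ltW (le_lt_trans ib bj).
- by move=> i; rewrite inE => /le_trans; apply; rewrite lerDl mulr_ge0.
Qed.

End Dual.

(** * Weak duality for the optimal payoff *)

Section UpperBound.
Variables (R : realType) (V Ty : finType) (N : network R V Ty) (phi : Ty -> R).
Hypothesis phi_prob : is_prob_vector phi.
Let phi_t : nat -> Ty -> R := fun=> phi.

Lemma Omega_nonempty K : (0 < #|V|)%N -> (@Omega V K !=set0)%classic.
Proof.
move=> /card_gt0P[i _]; exists [ffun j => if j == i then K else 0%N].
rewrite /Omega /= (bigD1 i)//= ffunE eqxx big1 ?addn0// => j ji.
by rewrite ffunE (negPf ji).
Qed.

Lemma Omega_le K (q : state V) i : Omega K q -> (q i <= K)%N.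
Proof. by rewrite /Omega /= (bigD1 i)//= => <-; rewrite leq_addr. Qed.

Lemma W_T_norm_le1 K pi T : (0 < #|V|)%N -> `|W_T (N := N) phi_t K pi T| <= 1.
Proof.
move=> V0; have [q0 q0K] := Omega_nonempty K V0.
have avg1 q : Omega K q -> -1 <= avg_payoff phi_t pi q T <= 1.
  by move=> qK; rewrite -ler_norml (avg_payoff_norm_le1 pi phi_prob _ qK).
rewrite ler_norml; apply/andP; split.
  apply: lb_le_inf; first by exists (avg_payoff phi_t pi q0 T); exists q0.
  by move=> _ [q qK <-]; have /andP[] := avg1 _ qK.
apply: le_trans (_ : avg_payoff phi_t pi q0 T <= 1).
  apply: ge_inf; last by exists q0.
  by exists (-1) => _ [q qK <-]; have /andP[] := avg1 _ qK.
by have /andP[] := avg1 _ q0K.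
Qed.

(** The argument [policy N] makes the outer supremum range over a nonempty set. *)
Lemma Wstar_T_le K T c : (0 < #|V|)%N -> policy N ->
  (forall pi : policy N, forall q, Omega K q -> avg_payoff phi_t pi q T <= c) ->
  Wstar_T N phi_t K T <= c.
Proof.
move=> V0 pi0 H; have [q0 q0K] := Omega_nonempty K V0.
apply: ge_sup; first by exists (sup [set avg_payoff phi_t pi0 q T | q in @Omega V K]%classic); exists pi0.
move=> _ [pi _ <-]; apply: ge_sup.
  by exists (avg_payoff phi_t pi q0 T); exists q0.
by move=> _ [q qK <-]; exact: H.
Qed.

Lemma Wstar_T_norm_le1 K T : (0 < #|V|)%N -> policy N ->
  `|Wstar_T N phi_t K T| <= 1.
Proof.
move=> V0 pi0; have [q0 q0K] := Omega_nonempty K V0.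
have avg1 (pi : policy N) q : Omega K q -> -1 <= avg_payoff phi_t pi q T <= 1.
  by move=> qK; rewrite -ler_norml (avg_payoff_norm_le1 pi phi_prob _ qK).
rewrite ler_norml; apply/andP; split; last first.
  by apply: Wstar_T_le => // pi q qK; have /andP[] := avg1 pi _ qK.
have sup1 pi : ubound [set avg_payoff (N := N) phi_t pi q T | q in @Omega V K]%classic 1.
  by move=> _ [q qK <-]; have /andP[] := avg1 pi _ qK.
apply: le_trans (_ : avg_payoff phi_t pi0 q0 T <= _).
  by have /andP[] := avg1 pi0 _ q0K.
apply: le_trans (_ : sup [set avg_payoff phi_t pi0 q T | q in @Omega V K]%classic <= _).
  by apply: ub_le_sup; [exists 1; exact: sup1 | exists q0].
apply: ub_le_sup; last by exists pi0.
exists 1 => _ [pi _ <-]; apply: ge_sup; last exact: sup1.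
by exists (avg_payoff phi_t pi q0 T); exists q0.
Qed.

(* Weak duality: with multipliers [y], the potential [- \sum_i y i * q i]
   telescopes. *)
Lemma Wstar_le_dual K y : (0 < #|V|)%N -> policy N ->
  Wstar N phi_t K <= dual N phi y.
Proof.
move=> V0 pi0; pose B := \sum_i `|y i| * K%:R.
apply: (@limn_sup_le _ _ _ (2 * B) 1).
- by move=> T; exact: Wstar_T_norm_le1.
- move=> T; apply: Wstar_T_le => // pi q.
  apply: (avg_payoff_le phi_prob (Phi := fun q => - \sum_i y i * (q i)%:R)
    (b := fun _ => dual_type N y)) => //.
    move=> q' q'K; rewrite normrN; apply: le_trans (ler_norm_sum _ _ _) _.
    apply: ler_sum => i _; rewrite normrM ler_wpM2l// normr_nat ler_nat.
    exact: Omega_le.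
  move=> h q' tau x q'K /(kernel_feasible (p := pi)) /feasibleP[|j k jP kD qj].
    by rewrite payoff_drop next_state_drop add0r lerDl dual_type_ge0.
  rewrite payoff_serve next_state_serve; have := dual_type_ge y jP kD.
  have [<-|jk] := eqVneq j k; first by rewrite move_id//; lra.
  rewrite (sum_move (fun i n => y i * n%:R))//=.
  have -> : (q' j)%:R = (q' j).-1%:R + 1 :> R by rewrite natr1 prednK.
  by rewrite -natr1; lra.
- by rewrite mulr_ge0// sumr_ge0// => i _; rewrite mulr_ge0.
Qed.

End UpperBound.

(** * Drift of mirror backpressure *)

Section Mirror.
Variable R : realType.
Implicit Types (a b r s t : R).

Lemma sqrt_congestionE m a :
  0 <= a -> sqrt_congestion m a = - (Num.sqrt m%:R / Num.sqrt a) :> R.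
Proof. by move=> a0; rewrite /sqrt_congestion powRN powR12_sqrt// mulNr. Qed.

(* Bounds the Bregman divergence of [-2 sqrt] between [t ^+ 2] and [s ^+ 2]. *)
Lemma sqrt_bregman_le s t : 0 < s -> 0 <= t ->
  - 2 * (t - s) <=
  - ((t ^+ 2 - s ^+ 2) / s) + (t ^+ 2 - s ^+ 2) ^+ 2 / s ^+ 3.
Proof.
move=> s0 t0; rewrite -subr_ge0.
have -> : - ((t ^+ 2 - s ^+ 2) / s) + (t ^+ 2 - s ^+ 2) ^+ 2 / s ^+ 3 -
    - 2 * (t - s) = (t - s) ^+ 2 * (t ^+ 2 + 2 * s * t) / s ^+ 3.
  by field; rewrite gt_eqF.
rewrite divr_ge0 ?exprn_ge0 ?(ltW s0)// mulr_ge0 ?sqr_ge0//.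
by rewrite addr_ge0 ?sqr_ge0// !mulr_ge0// ltW.
Qed.

(* [r], [s], [t] stand for the square roots of [m], of the smallest normalized
   queue length and of [K]; [e] flags an empty queue. When [4 r s >= 1] the
   second-order term is [O(m^2 / K)] and no queue is empty; otherwise the
   spread of the congestion costs pays for both. *)
Lemma residual_le r s t al e w D (kp := t ^+ 2 + r ^+ 2 * t) :
  1 <= r -> 0 < s -> 0 < t -> 0 < al <= 1 ->
  257 * r ^+ 4 + 4096 * al^-1 ^+ 4 <= t ^+ 2 ->
  t <= kp * s ^+ 2 ->
  e = 0 \/ e = 1 /\ kp * s ^+ 2 = t ->
  w <= D -> w + al * (r / s - r ^+ 2 - 2 * r ^+ 2) <= D ->
  2 * (r / (kp * s ^+ 3)) + e - D <= - (w - 128 * r ^+ 4 / t ^+ 2).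
Proof.
move=> r1 s0 t0 /andP[al0 al1] Kbig ts es wD1 wD2.
have r0 : 0 < r by lra.
have kp0 : 0 < kp by rewrite addr_gt0 ?mulr_gt0 ?exprn_gt0.
have kpt : t ^+ 2 <= kp by rewrite lerDl mulr_ge0 ?exprn_ge0// ltW.
have r41 : 1 <= r ^+ 4 by rewrite exprn_ege1.
have ali4 : 0 <= al^-1 ^+ 4 by rewrite exprn_ge0// invr_ge0 ltW.
have es0 : e != 0 -> s ^+ 2 * t <= 1.
  case: es => [->|[_ E] _]; first by rewrite eqxx.
  rewrite -(ler_pM2l t0) mulr1 -[leRHS]E mulrCA mulrA -[leLHS]mulrA.
  by rewrite mulrC -expr2 ler_wpM2r// sqr_ge0.
have [rs|rs] := leP 1 (4 * (r * s)).
  have e0 : e = 0.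
    (* An empty queue would give [s ^+ 2 * t <= 1], hence [t <= 16 * r ^+ 2] and
       [t ^+ 2 <= 256 * r ^+ 4], which the coefficient 257 excludes. *)
    apply: contrapT => /eqP /es0 st1.
    have : 1 <= (4 * (r * s)) ^+ 2 by rewrite exprn_ege1.
    rewrite !exprMn => rs2.
    have : t <= 16 * r ^+ 2 by nra.
    move=> t16; have : t ^+ 2 <= (16 * r ^+ 2) ^+ 2.
      by rewrite lerXn2r// ?nnegrE ?ltW// mulr_gt0// exprn_gt0.
    by rewrite exprMn -exprM => ?; lra.
  rewrite e0 addr0; suff : 2 * (r / (kp * s ^+ 3)) <= 128 * r ^+ 4 / t ^+ 2 by lra.
  (* Cubing [4 r s >= 1] costs a factor 64, whence the constant 128 = 2 * 64. *)
  have rs3 : 1 <= (4 * (r * s)) ^+ 3 by rewrite exprn_ege1.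
  apply: (@le_trans _ _ (128 * r ^+ 4 / kp)); last first.
    by rewrite ler_wpM2l ?mulr_ge0 ?exprn_ge0 ?(ltW r0)// lef_pV2// posrE exprn_gt0.
  have -> : 2 * (r / (kp * s ^+ 3)) = 2 * r / s ^+ 3 / kp.
    by field; rewrite !gt_eqF.
  rewrite ler_wpM2r ?invr_ge0 ?(ltW kp0)// ler_pdivrMr ?exprn_gt0//.
  have -> : 128 * r ^+ 4 * s ^+ 3 = 2 * r * (4 * (r * s)) ^+ 3 by ring.
  by rewrite -[leLHS]mulr1 ler_wpM2l//; lra.
have M0 : 0 <= 128 * r ^+ 4 / t ^+ 2.
  by rewrite mulr_ge0 ?invr_ge0 ?mulr_ge0 ?exprn_ge0// ltW.
(* So at least a quarter of [r / s] remains after subtracting [3 * r ^+ 2]; one eighth pays for the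
   second-order term, the other for [e]. *)
have rs4 : 4 * r ^+ 2 <= r / s.
  by rewrite ler_pdivlMr// expr2; nra.
(* The coefficient 4096 is the square of 64, the value that yields [8 * s <= al] below when a queue
   is empty. *)
have tal : 64 <= al ^+ 2 * t.
  rewrite -(@ler_pXn2r _ 2) ?nnegrE ?mulr_ge0 ?exprn_ge0 ?(ltW t0) ?(ltW al0)//.
  have al4 : 0 < al ^+ 4 by rewrite exprn_gt0.
  have -> : (al ^+ 2 * t) ^+ 2 = al ^+ 4 * t ^+ 2 by ring.
  have -> : 64 ^+ 2 = 4096 :> R by ring.
  rewrite [leRHS]mulrC -ler_pdivrMr ?exprn_gt0// -exprVn; apply: le_trans Kbig.
  by rewrite lerDr mulr_ge0// exprn_ge0// ltW.
have first : 2 * (r / (kp * s ^+ 3)) <= al * (r / s) / 8.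
  have -> : 2 * (r / (kp * s ^+ 3)) = (r / s) * (2 / (kp * s ^+ 2)).
    by field; rewrite !gt_eqF.
  have -> : al * (r / s) / 8 = (r / s) * (al / 8) by ring.
  rewrite ler_wpM2l ?divr_ge0 ?(ltW r0) ?(ltW s0)//.
  rewrite ler_pdivrMr ?mulr_gt0 ?exprn_gt0//.
  have : al * t <= al * (kp * s ^+ 2) by rewrite ler_wpM2l// ltW.
  have : al ^+ 2 * t <= al * t by rewrite ler_wpM2r ?(ltW t0)// expr2; nra.
  lra.
have second : e <= al * (r / s) / 8.
  have [->|e0] := eqVneq e 0.
    by rewrite !mulr_ge0 ?invr_ge0 ?(ltW r0) ?(ltW s0) ?(ltW al0).
  have -> : e = 1 by case: es e0 => [->|[]//]; rewrite eqxx.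
  have s2 : (8 * s) ^+ 2 <= al ^+ 2.
    rewrite exprMn; apply: (@le_trans _ _ (al ^+ 2 * t * s ^+ 2)).
      by rewrite [8 ^+ 2](_ : _ = 64) ?ler_wpM2r ?sqr_ge0//; ring.
    rewrite -mulrA mulrC [t * _]mulrC -[leRHS]mul1r ler_wpM2r ?sqr_ge0//.
    exact: es0.
  have s8 : 8 * s <= al.
    by rewrite -(@ler_pXn2r _ 2) ?nnegrE ?mulr_ge0 ?(ltW s0) ?(ltW al0).
  by rewrite mulrA mulrAC ler_pdivlMr// mul1r ler_pdivlMr//; nra.
have : al * (r / s / 4) <= al * (r / s - r ^+ 2 - 2 * r ^+ 2).
  by rewrite ler_wpM2l ?(ltW al0)//; lra.
lra.
Qed.

End Mirror.

(** * The mirror potential, its drift and the loss of MBP *)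

Section Drift.
Variables (R : realType) (V Ty : finType) (N : network R V Ty) (K : nat).
Hypotheses (V_gt0 : (0 < #|V|)%N) (K_gt0 : (0 < K)%N).
Implicit Types (q : state V) (n : nat).

Let r : R := Num.sqrt #|V|%:R.
Let t : R := Num.sqrt K%:R.
Let kp : R := K%:R + #|V|%:R * t.
Let f : R -> R := sqrt_congestion #|V|.
Let sq n : R := Num.sqrt ((n%:R + t) / kp).

(** An antiderivative of [f] at the normalized lengths, scaled by [kp] so that the partial
    derivative in [q i] is [f (qbar R K q i)]. *)
Definition potential q : R := \sum_i - 2 * kp * r * sq (q i).

Let r2 : r ^+ 2 = #|V|%:R. Proof. by rewrite sqr_sqrtr. Qed.
Let r_gt0 : 0 < r. Proof. by rewrite sqrtr_gt0 ltr0n. Qed.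
Let t2 : t ^+ 2 = K%:R. Proof. by rewrite sqr_sqrtr. Qed.
Let t_gt0 : 0 < t. Proof. by rewrite sqrtr_gt0 ltr0n. Qed.
Let kp_gt0 : 0 < kp.
Proof. by rewrite addr_gt0 ?mulr_gt0 ?ltr0n. Qed.

Let qbar_gt0 n : 0 < (n%:R + t) / kp.
Proof. by rewrite divr_gt0// ltr_wpDl. Qed.

Let sq_gt0 n : 0 < sq n. Proof. by rewrite sqrtr_gt0. Qed.

Let sq2 n : sq n ^+ 2 = (n%:R + t) / kp.
Proof. by rewrite sqr_sqrtr// ltW. Qed.

Let le_sq n n' : (n <= n')%N -> sq n <= sq n'.
Proof.
by move=> nn'; rewrite ler_wsqrtr// ler_pM2r ?invr_gt0// lerD2r ler_nat.
Qed.

Let fE q i : f (qbar R K q i) = - (r / sq (q i)).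
Proof. exact: (sqrt_congestionE _ (ltW (qbar_gt0 (q i)))). Qed.

(** This is [sqrt_bregman_le] multiplied by [kp * r], the normalized lengths differing by
    [d / kp]. *)
Let node_step n n' (d : R) : n'%:R = n%:R + d ->
  - 2 * kp * r * sq n' - - 2 * kp * r * sq n <=
  - d * (r / sq n) + d ^+ 2 * (r / (kp * sq n ^+ 3)).
Proof.
move=> nd; have := sqrt_bregman_le (sq_gt0 n) (ltW (sq_gt0 n')).
rewrite !sq2 nd -mulrBl (_ : n%:R + d + t - (n%:R + t) = d); last by ring.
have kr0 : 0 <= kp * r by rewrite mulr_ge0 ?ltW.
move=> /(ler_wpM2l kr0).
have -> : kp * r * (-2 * (sq n' - sq n)) =
    - 2 * kp * r * sq n' - - 2 * kp * r * sq n by ring.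
move=> /le_trans; apply; rewrite le_eqVlt; apply/orP; left; apply/eqP.
by field; rewrite !gt_eqF.
Qed.

Let le_curvature n n' : (n <= n')%N ->
  r / (kp * sq n' ^+ 3) <= r / (kp * sq n ^+ 3).
Proof.
move=> nn'; rewrite ler_wpM2l ?(ltW r_gt0)// lef_pV2 ?posrE ?mulr_gt0 ?exprn_gt0//.
by rewrite ler_wpM2l ?(ltW kp_gt0)// lerXn2r ?nnegrE ?(ltW (sq_gt0 _)) ?le_sq.
Qed.

Lemma mbp_drift q tau x i0 : (forall i, (q i0 <= q i)%N) ->
  mbp_decision N f K q tau x ->
  - payoff N tau x + potential (next_state q tau x) <=
  potential q + (2 * (r / (kp * sq (q i0) ^+ 3)) + (q i0 == 0%N)%:R -
    dual_type N (fun i => f (qbar R K q i)) tau).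
Proof.
move=> qmin [j [k [[jP kD opt] ->]]].
pose y i : R := f (qbar R K q i); set D := dual_type _ _ _.
set c := r / _; have c0 : 0 <= c.
  by rewrite divr_ge0 ?mulr_ge0 ?exprn_ge0 ?(ltW kp_gt0) ?(ltW r_gt0) ?(ltW (sq_gt0 _)).
have e0 : 0 <= (q i0 == 0%N)%:R :> R by rewrite ler0n.
have Ds : 0 <= score N f K q tau j k -> D <= weight N j tau k + y j - y k.
  by move=> s0; apply: dual_type_le => // j' k' j'P k'D; exact: opt.
have [s0|s0] /= := leP 0 (score N f K q tau j k); last first.
  rewrite payoff_drop next_state_drop; have : D <= 0.
    by apply: dual_type_le => // j' k' j'P k'D; apply: le_trans (opt _ _ j'P k'D) (ltW s0).
  lra.
have [qj|qj] := posnP (q j).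
  rewrite payoff_drop next_state_drop.
  have qi0 : q i0 = 0%N by apply/eqP; rewrite -leqn0 -qj.
  (* An empty [j] is a shortest queue, so its congestion cost can only lower the score: the lost
     value is at most the payoff, hence at most 1. *)
  have yjk : y j <= y k.
    rewrite /y !fE lerN2 ler_wpM2l ?(ltW r_gt0)// lef_pV2 ?posrE// le_sq//.
    by rewrite qj.
  have := weight_le1 jP kD; rewrite ler_norml => /andP[_ w1].
  by have := Ds s0; rewrite qi0 eqxx /=; lra.
rewrite payoff_serve next_state_serve; have {}Ds := Ds s0.
have [jk|jk] := eqVneq j k.
  by move: Ds; rewrite -jk move_id//; lra.
rewrite /potential (sum_move (fun _ n => - 2 * kp * r * sq n))//=.
have qj1 : (q j).-1%:R = (q j)%:R + -1 :> R.
  by rewrite -[in RHS](prednK qj) -natr1 addrK.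
have := node_step qj1; have := node_step (esym (natr1 (q k))).
(* The first-order terms at [j] and [k] add up to [y k - y j], completing the score; both
   second-order coefficients are largest at the shortest queue. *)
have := le_curvature (qmin j); have := le_curvature (qmin k).
rewrite -/c /y !fE in Ds *.
move: (r / (kp * _)) (r / (kp * _)) => c1 c2.
rewrite sqrrN !expr1n !mul1r => *; lra.
Qed.

Lemma potential_norm_le q : Omega K q -> `|potential q| <= 2 * kp * r * #|V|%:R.
Proof.
move=> qK; apply: le_trans (ler_norm_sum _ _ _) _.
rewrite -sum1_card natr_sum mulr_sumr; apply: ler_sum => i _.
rewrite !normrM normrN normr_nat !gtr0_norm// ler_pM2l ?mulr_gt0//.
rewrite -[leRHS]sqrtr1 ler_wsqrtr// ler_pdivrMr// mul1r lerD//.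
  by rewrite ler_nat (Omega_le _ qK).
by rewrite -[leLHS]mul1r ler_wpM2r ?(ltW t_gt0)// ler1n.
Qed.

Lemma mbp_rate (phi : Ty -> R) w q i0 :
  is_prob_vector phi -> 0 < alpha N phi -> (forall y, w <= dual N phi y) ->
  257 * #|V|%:R ^+ 2 + 4096 * (alpha N phi)^-1 ^+ 4 <= K%:R ->
  Omega K q -> (forall i, (q i0 <= q i)%N) ->
  \sum_tau phi tau * (2 * (r / (kp * sq (q i0) ^+ 3)) + (q i0 == 0%N)%:R -
    dual_type N (fun i => f (qbar R K q i)) tau) <=
  - (w - 128 * #|V|%:R ^+ 2 / K%:R).
Proof.
move=> [phi0 phi1] al0 wd Kbig qK qmin.
have -> c y : \sum_tau phi tau * (c - dual_type N y tau) = c - dual N phi y.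
  under eq_bigr do rewrite mulrBr.
  by rewrite big_split sumrN -big_distrl /= phi1 mul1r.
set y := fun i => f _.
have kpE : kp = t ^+ 2 + r ^+ 2 * t by rewrite t2 r2.
have m2 : #|V|%:R ^+ 2 = r ^+ 4 by rewrite -r2 -exprM.
rewrite m2 -t2 kpE; apply: (residual_le (al := alpha N phi)) => //.
- by rewrite -[leLHS]sqrtr1 ler_wsqrtr ?ler1n.
- by rewrite al0 alpha_le1.
- by rewrite t2 -m2.
- by rewrite -kpE sq2 mulrC divfK ?gt_eqF// lerDr.
- have [->|_] := eqVneq (q i0) 0%N; last by left.
  by right; rewrite -kpE sq2 add0r mulrC divfK ?gt_eqF.
(* A longest queue holds at least [K / m] units, so its normalized length is at least [1 / m] and
   [y a >= - m]. With the [2 m] of [dual_spread] this is the [3 * r ^+ 2] subtracted in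
   [residual_le]. *)
pose a := [arg max_(i > i0) q i]%N.
have amax i : (q i <= q a)%N by rewrite /a; case: arg_maxnP => // j _; exact.
apply: le_trans _ (dual_spread phi0 y a i0 (ltW al0) wd).
rewrite lerD2l ler_wpM2l ?(ltW al0)// -r2 lerD2r /y !fE.
suff : r / sq (q a) <= r ^+ 2 by lra.
rewrite ler_pdivrMr// -[leLHS]mulr1 expr2 -mulrA ler_wpM2l ?(ltW r_gt0)//.
rewrite -(@ler_pXn2r _ 2) ?nnegrE ?mulr_ge0 ?(ltW r_gt0) ?(ltW (sq_gt0 _))// expr1n exprMn sq2 r2.
rewrite mulrA ler_pdivlMr// mul1r mulrDr lerD2r -natrM ler_nat -qK.
by rewrite -sum_nat_const; apply: leq_sum.
Qed.

Lemma mbp_loss (phi : Ty -> R) (pi : policy N) :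
  is_prob_vector phi -> 0 < alpha N phi ->
  257 * #|V|%:R ^+ 2 + 4096 * (alpha N phi)^-1 ^+ 4 <= K%:R ->
  is_MBP f K pi ->
  loss (fun=> phi) K pi <= 128 * #|V|%:R ^+ 2 / K%:R.
Proof.
move=> phi_prob al0 Kbig mbp; rewrite /loss lerBlDr -lerBlDl.
have [i _] : exists i, i \in V by apply/card_gt0P.
pose imin q := [arg min_(i < i) q i]%N.
have qmin q j : (q (imin q) <= q j)%N.
  by rewrite /imin; case: arg_minnP => // k _; exact.
(* The optimal payoff itself serves as the lower bound [w] of the dual. *)
have Wd y := Wstar_le_dual phi_prob K y V_gt0 pi.
apply: (@limn_inf_ge _ _ _ (2 * (2 * kp * r * #|V|%:R)) 1).
- by move=> T; exact: W_T_norm_le1.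
- move=> T; have [q0 q0K] := Omega_nonempty K V_gt0.
  apply: lb_le_inf.
    by exists (avg_payoff (fun=> phi) pi q0 T.+1); exists q0.
  move=> _ [q qK <-].
  apply: (avg_payoff_ge phi_prob potential_norm_le
    (c := Wstar N (fun=> phi) K - 128 * #|V|%:R ^+ 2 / K%:R) _ _ T qK).
    by move=> q' q'K; exact: (mbp_rate phi_prob al0 Wd Kbig q'K (qmin q')).
  move=> h q' tau x q'K px; by apply: mbp_drift => //; exact: mbp px.
- by rewrite !mulr_ge0 ?(ltW kp_gt0) ?(ltW r_gt0).
Qed.

End Drift.

Theorem corollary1 (R : realType) :
  exists (P : {poly {poly R}}) (C : R),
    forall (V Ty : finType) (N : network R V Ty) (phi : Ty -> R) (K : nat)
           (MBP : policy N),
      let m := #|V| in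
      let phi_t : nat -> Ty -> R := fun=> phi in
      let K1 := P.[m%:R, (alpha N phi)^-1] in
      (1 < m)%N ->
      is_prob_vector phi ->
      0 < alpha N phi ->
      (0 < K)%N ->
      is_MBP (sqrt_congestion m) K MBP ->
      K1 <= K%:R ->
      loss phi_t K MBP <= C * m%:R ^+ 2 * K%:R^-1.
Proof.
(* The outer indeterminate stands for [m], the inner one for the inverse of [alpha]; all constants
   come from [residual_le]. *)
exists (257%:P *: 'X ^+ 2 + (4096 *: 'X ^+ 4)%:P), 128.
move=> V Ty N phi K pi m phi_t K1 m1 phi_prob al0 K0 mbp K1K.
apply: mbp_loss => //; first exact: ltnW.
by move: K1K; rewrite /K1 !hornerE.
Qed.
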